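(* Let $N\geq3$ and let $\rho$ be the unique positive real root of $X^N-X^{N-1}-\cdots-X-1$. (1) Let $\mathcal T$ be the inflation–substitution tiling with prototiles $R_j$ of length $\rho^{1-j}$ ($1\leq j\leq N$), initial tile $[0,1]=R_1$ and substitution rules $\rho R_1=R_1|R_2|\cdots|R_N$, $\rho R_j=R_{j-1}$ for $2\leq j\leq N$. Then every $\rho$-integer is an endpoint of some tile of $\mathcal T$ (the tiling of $[0,\infty)$ whose endpoints are the $\rho$-integers is subordinate to $\mathcal T$). (2) Let $\widehat{\mathcal T}$ be the inflation–substitution tiling with prototiles $\widehat R_1,\dots,\widehat R_N$ of lengths $1$ and $\sum_{i=1}^{N-j+1}\rho^{-i}$ for $2\leq j\leq N$ (i.e. $1,\ \frac1\rho+\cdots+\frac1{\rho^{N-1}},\ \dots,\ \frac1\rho$), initial tile $[0,1]=\widehat R_1$, and substitution rules $\rho\widehat R_j=\widehat R_1|\widehat R_{j+1}$ for $1\leq j\leq N-1$, $\rho\widehat R_N=\widehat R_1$. Then $\widehat{\mathcal T}$ is inflationary with multiplier $\rho$, and the set of its endpoints is exactly the set of $\rho$-integers.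
   Context: A non-negative real number is a $\rho$-integer if it equals $\sum_{i=0}^{n}c_i\rho^{n-i}$ for some $n\in\mathbb N_0$ and $c_i\in\{0,1\}$. Inflation–substitution tiling: given prototiles (intervals of given lengths) and for each prototile a finite word in the prototiles (the substitution rule, written $\rho R=\cdots$, whose lengths sum to $\rho$ times the length of $R$) such that the word for the initial prototile begins with that prototile, start with the one-letter word consisting of the initial prototile and repeatedly replace every letter by its word; each word is a prefix of the next, so they converge to an infinite word, and laying intervals of the corresponding lengths consecutively starting at $0$ gives a tiling of $[0,\infty)$, with endpoints the partial sums of lengths. A tiling $\mathcal T'$ is subordinate to $\mathcal T$ if every endpoint of $\mathcal T'$ is an endpoint of $\mathcal T$. A tiling with endpoints $0=y_0<y_1<\cdots$ is inflationary with multiplier $\rho$ if there is a rule assigning to each occurring tile length $\ell$ an ordered list of occurring lengths with sum $\rho\ell$ such that each $[\rho y_{i-1},\rho y_i]$ is exactly the union of consecutive tiles whose lengths in order form the list assigned to $y_i-y_{i-1}$. *)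

(* Defs.v *)
From HB Require Import structures.
From mathcomp Require Import all_boot all_order all_algebra.
From mathcomp Require Import all_classical all_reals.

Set Implicit Arguments.
Unset Strict Implicit.
Unset Printing Implicit Defensive.
Import Order.TTheory GRing.Theory Num.Theory.
Local Open Scope classical_set_scope.
Local Open Scope ring_scope.

Definition nbonacci_poly (R : nzRingType) (N : nat) : {poly R} :=
  'X^N - \sum_(i < N) 'X^i.

Definition rho_integers (R : realType) (rho : R) : set R :=
  [set x | 0 <= x /\ exists (n : nat) (c : 'I_n.+1 -> bool),
     x = \sum_(i < n.+1) (c i)%:R * rho ^+ (n - i)].

(* A tiling of [0, +oo[ is given by its increasing sequence of endpoints. *)
Definition is_tiling (R : realType) (y : nat -> R) : Prop :=
  [/\ y 0%N = 0, forall n, y n < y n.+1 & forall x, exists n, x < y n].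

Definition endpoints (R : realType) (y : nat -> R) : set R := range y.

Definition tile_length (R : realType) (y : nat -> R) (i : nat) : R :=
  y i.+1 - y i.

Definition subordinate (R : realType) (y' y : nat -> R) : Prop :=
  [/\ is_tiling y', is_tiling y & endpoints y' `<=` endpoints y].

Definition inflationary (R : realType) (rho : R) (y : nat -> R) : Prop :=
  is_tiling y /\
  exists rule : R -> seq R, forall i : nat,
    let s := rule (tile_length y i) in
    [/\ forall l, l \in s -> range (tile_length y) l,
        \sum_(l <- s) l = rho * tile_length y i
      & exists k : nat,
          [/\ y k = rho * y i, y (k + size s)%N = rho * y i.+1
            & forall m, (m < size s)%N -> tile_length y (k + m) = nth 0 s m]].

(* [P] selects the labels in [A] that actually name prototiles. *)
Definition inflation_substitution (R : realType) (A : Type) (P : pred A)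
    (rho : R) (len : A -> R) (rule : A -> seq A) (a0 : A) : Prop :=
  [/\ P a0,
      forall a, P a -> 0 < len a,
      forall a, P a -> all P (rule a),
      forall a, P a -> \sum_(b <- rule a) len b = rho * len a
    & exists u, rule a0 = a0 :: u].

Definition substitute (A : Type) (rule : A -> seq A) (w : seq A) : seq A :=
  flatten (map rule w).

Definition inflation_word (A : Type) (rule : A -> seq A) (a0 : A) (k : nat) :
  seq A := iter k (substitute rule) [:: a0].

(* The [n]-th iterate has more than [n] letters, so it already determines the
   [n]-th letter of the limit; see [inflation_word_limit]. *)
Definition limit_word (A : Type) (rule : A -> seq A) (a0 : A) (n : nat) : A :=
  nth a0 (inflation_word rule a0 n) n.

Definition inflation_tiling (R : realType) (A : Type) (len : A -> R)
    (rule : A -> seq A) (a0 : A) (n : nat) : R :=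
  \sum_(i < n) len (limit_word rule a0 i).

(* Prototiles are labelled 1, ..., N; other labels never occur in the words. *)
Definition is_label (N : nat) : pred nat := fun j => (1 <= j <= N)%N.

Definition len_R (R : realType) (rho : R) (j : nat) : R := rho ^- (j - 1).

Definition rule_R (N j : nat) : seq nat :=
  if j == 1%N then iota 1 N else [:: j.-1].

Definition tiling_R (R : realType) (N : nat) (rho : R) : nat -> R :=
  inflation_tiling (len_R rho) (rule_R N) 1%N.

Definition len_hatR (R : realType) (N : nat) (rho : R) (j : nat) : R :=
  if j == 1%N then 1 else \sum_(1 <= i < (N - j + 1).+1) rho ^- i.

Definition rule_hatR (N j : nat) : seq nat :=
  if (j < N)%N then [:: 1%N; j.+1] else [:: 1%N].

Definition tiling_hatR (R : realType) (N : nat) (rho : R) : nat -> R :=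
  inflation_tiling (len_hatR N rho) (rule_hatR N) 1%N.

Lemma substitute_cat (A : Type) (rule : A -> seq A) (v w : seq A) :
  substitute rule (v ++ w) = substitute rule v ++ substitute rule w.
Proof. by rewrite /substitute map_cat flatten_cat. Qed.

Lemma inflation_word_prefix (R : realType) (A : Type) (P : pred A) (rho : R)
    (len : A -> R) (rule : A -> seq A) (a0 : A) :
  1 < rho -> inflation_substitution P rho len rule a0 ->
  forall k, exists v, [/\ (0 < size v)%N, all P v
    & inflation_word rule a0 k.+1 = inflation_word rule a0 k ++ v].
Proof.
move=> rho1 [Pa0 lenP ruleP sumP [u ru]]; elim=> [|k [v [v0 Pv vE]]].
  exists u; split; last by rewrite /inflation_word /= /substitute /= cats0.
    case: u ru (sumP _ Pa0) => // -> /eqP; rewrite big_seq1.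
    by rewrite -subr_eq0 -{1}[len a0]mul1r -mulrBl mulf_eq0 subr_eq0
      (lt_eqF rho1) gt_eqF ?lenP.
  by have := ruleP _ Pa0; rewrite ru /= => /andP[].
exists (substitute rule v); split; last first.
- by rewrite [LHS]/inflation_word iterS -/(inflation_word _ _ k.+1) {1}vE
    substitute_cat -[substitute rule (inflation_word _ _ k)]/(inflation_word _ _ k.+1).
- elim: v {v0 vE} Pv => //= a v IH /andP[Pa /IH Pv].
  by rewrite /substitute /= all_cat ruleP.
case: v v0 Pv {vE} => //= a v _ /andP[Pa _].
rewrite /substitute /= size_cat addn_gt0.
case: (rule a) (sumP _ Pa) => //= /eqP; rewrite big_nil eq_sym mulf_eq0.
by rewrite !gt_eqF ?lenP // (lt_trans ltr01 rho1).
Qed.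

Lemma inflation_word_limit (R : realType) (A : Type) (P : pred A) (rho : R)
    (len : A -> R) (rule : A -> seq A) (a0 : A) :
  1 < rho -> inflation_substitution P rho len rule a0 ->
  forall k, (k < size (inflation_word rule a0 k))%N /\
    inflation_word rule a0 k =
    mkseq (limit_word rule a0) (size (inflation_word rule a0 k)).
Proof.
move=> rho1 infl; set W := inflation_word rule a0.
have step := inflation_word_prefix rho1 infl.
have sz k : (k < size (W k))%N.
  elim: k => // k IH; have [v [v0 _ E]] := step k.
  by rewrite /W E size_cat -addn1 leq_add.
have pre k d : exists v, W (k + d)%N = W k ++ v.
  elim: d => [|d [v vE]]; first by exists [::]; rewrite addn0 cats0.
  have [v' [_ _ E]] := step (k + d)%N; exists (v ++ v').
  by rewrite addnS /W E -/(W _) vE catA.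
move=> k; split=> //; apply: (@eq_from_nth _ a0); first by rewrite size_mkseq.
move=> i ik; rewrite nth_mkseq // /limit_word -/(W i).
have [ki|/ltnW ki] := leqP k i.
  by have [v] := pre k (i - k)%N; rewrite subnKC // => ->; rewrite nth_cat ik.
by have [v] := pre i (k - i)%N; rewrite subnKC // => ->; rewrite nth_cat sz.
Qed.

Lemma root_nbonacciE (R : realType) (N : nat) (x : R) :
  root (nbonacci_poly R N) x = (x ^+ N == \sum_(i < N) x ^+ i).
Proof.
rewrite rootE /nbonacci_poly hornerD hornerN hornerXn horner_sum subr_eq0.
by under eq_bigr do rewrite hornerXn.
Qed.

Lemma nbonacci_root_sum (R : realType) (N : nat) (x : R) :
  0 < x -> root (nbonacci_poly R N) x -> \sum_(1 <= i < N.+1) x ^- i = 1.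
Proof.
move=> x0; rewrite root_nbonacciE => /eqP xN.
have xn0 : x != 0 by rewrite gt_eqF.
apply: (mulfI (expf_neq0 N xn0)); rewrite mulr1 {2}xN mulr_sumr.
rewrite big_nat_rev big_add1 big_mkord; apply: eq_bigr => i _ /=.
have iN : (i <= N)%N := ltnW (ltn_ord i).
by rewrite add1n !subSS -{1}(subnKC iN) exprD mulfK ?expf_neq0.
Qed.

Lemma nbonacci_root_unique (R : realType) (N : nat) (x y : R) :
  (0 < N)%N -> 0 < x -> root (nbonacci_poly R N) x ->
  0 < y -> root (nbonacci_poly R N) y -> x = y.
Proof.
move=> N0; wlog xy : x y / x < y.
  by move=> H; case: (ltgtP x y) => // xy *; [apply: H | symmetry; apply: H].
move=> x0 /(nbonacci_root_sum x0) sx y0 /(nbonacci_root_sum y0) sy.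
suff : \sum_(1 <= i < N.+1) y ^- i < \sum_(1 <= i < N.+1) x ^- i.
  by rewrite sx sy ltxx.
apply: ltr_sum_nat => // i /andP[i0 _].
by rewrite ltf_pV2 ?posrE ?exprn_gt0 // ltrXn2r // -?lt0n // ?i0 ltW.
Qed.

Lemma nbonacci_root_exists (R : realType) (N : nat) :
  (0 < N)%N -> exists2 x : R, 0 < x & root (nbonacci_poly R N) x.
Proof.
move=> N0; have pE (x : R) : (nbonacci_poly R N).[x] = x ^+ N - \sum_(i < N) x ^+ i.
  rewrite /nbonacci_poly hornerD hornerN hornerXn horner_sum.
  by under eq_bigr do rewrite hornerXn.
have sgn : (nbonacci_poly R N).[1] <= 0 <= (nbonacci_poly R N).[2].
  rewrite !pE expr1n; apply/andP; split.
    under eq_bigr do rewrite expr1n.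
    by rewrite sumr_const card_ord subr_le0 ler1n.
  have := subrX1 (2 : R) N; rewrite (_ : 2 - 1 = 1 :> R) ?mul1r => [<-|].
    by rewrite opprB addrC subrK.
  by rewrite mulr2n addrK.
have [|x /andP[x1 _] rx] := poly_ivt _ sgn; first by rewrite ler1n.
by exists x => //; apply: lt_le_trans x1.
Qed.

Lemma nbonacci_root_gt1 (R : realType) (N : nat) (rho : R) :
  (3 <= N)%N -> 0 < rho -> root (nbonacci_poly R N) rho -> 1 < rho.
Proof.
move=> N3 r0 /(nbonacci_root_sum r0) s1; rewrite ltNge; apply/negP => r1.
have ge1 i : 1 <= rho ^- i by rewrite invf_ge1 ?exprn_gt0 // exprn_ile1 // ltW.
have : \sum_(1 <= i < N.+1) (1 : R) <= 1.
  by rewrite -[leRHS]s1; apply: ler_sum_nat => i _.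
by rewrite big_const_nat iter_addr_0 subn1 /= lern1 leqNgt (leq_trans _ N3).
Qed.

Lemma inflation_substitution_R (R : realType) (N : nat) (rho : R) :
  (3 <= N)%N -> 0 < rho -> root (nbonacci_poly R N) rho ->
  inflation_substitution (is_label N) rho (len_R rho) (rule_R N) 1%N.
Proof.
move=> N3 r0 rr; have N0 : (0 < N)%N by apply: leq_trans N3.
have rn0 : rho != 0 by rewrite gt_eqF.
split; rewrite /is_label ?N0 //.
- by move=> j _; rewrite invr_gt0 exprn_gt0.
- move=> j /andP[j1 jN]; rewrite /rule_R; case: eqP => [_|/eqP jn1].
    by apply/allP => i; rewrite mem_iota add1n ltnS.
  by rewrite /= andbT; case: j j1 jN jn1 => [//|[//|j]] _ /ltnW.
- move=> j /andP[j1 jN]; rewrite /rule_R /len_R; case: eqP => [->|/eqP jn1].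
    rewrite subnn expr0 invr1 -(nbonacci_root_sum r0 rr) mulr_sumr.
    rewrite (_ : iota 1 N = index_iota 1 N.+1); last by rewrite /index_iota subn1.
    rewrite !big_nat; apply: eq_bigr => -[//|i] _.
    by rewrite subn1 /= exprS invfM mulrA divff ?mul1r.
  case: j j1 jN jn1 => [//|[//|j]] _ _ _; rewrite big_seq1 !subn1 /=.
  by rewrite exprS invfM mulrA divff ?mul1r.
by exists (iota 2 N.-1); rewrite /rule_R eqxx -[in LHS](prednK N0).
Qed.

Lemma inflation_substitution_hatR (R : realType) (N : nat) (rho : R) :
  (3 <= N)%N -> 0 < rho -> root (nbonacci_poly R N) rho ->
  inflation_substitution (is_label N) rho (len_hatR N rho) (rule_hatR N) 1%N.
Proof.
move=> N3 r0 rr; have N1 : (1 < N)%N by apply: leq_trans N3.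
have rn0 : rho != 0 by rewrite gt_eqF.
have lenE j : is_label N j ->
    len_hatR N rho j = \sum_(1 <= i < (N - j + 1).+1) rho ^- i.
  move=> /andP[j1 jN]; rewrite /len_hatR; case: eqP => [->|//].
  by rewrite subnK ?nbonacci_root_sum // ltnW.
split; rewrite /is_label ?(ltnW N1) //.
- move=> j jP; rewrite lenE // addn1 big_nat_recl //= ltr_pwDl //.
    by rewrite invr_gt0 exprn_gt0.
  by apply: sumr_ge0 => i _; rewrite invr_ge0 exprn_ge0 // ltW.
- move=> j /andP[j1 jN]; rewrite /rule_hatR; case: ltnP => jN' /=.
    by rewrite jN' (ltnW N1).
  by rewrite (ltnW N1).
- move=> j jP; have /andP[j1 jN] := jP.
  rewrite (lenE j) // addn1 big_nat_recl // mulrDr expr1 divff //.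
  rewrite /rule_hatR; case: ltnP => jN'.
    rewrite big_cons big_seq1 (lenE j.+1) /is_label ?jN' // {1}/len_hatR eqxx.
    congr (_ + _); rewrite mulr_sumr subnS addn1 prednK ?subn_gt0 //.
    rewrite !big_add1 /=; apply: eq_bigr => i _.
    by rewrite [rho ^+ i.+2]exprS invfM mulrA divff ?mul1r.
  have -> : j = N by apply/eqP; rewrite eqn_leq jN.
  by rewrite subnn big_geq // mulr0 addr0 big_seq1 /len_hatR eqxx.
by exists [:: 2%N]; rewrite /rule_hatR N1.
Qed.

(* Main.v *)
(* The words of an inflation-substitution tiling are prefixes of a limit word
   fixed by the substitution, so its endpoints are stable under multiplication
   by rho, and equal lengths are inflated equally as soon as the lengths of the
   prototiles are distinct.  In the second tiling every rule is either
   R1 | R_(j+1) or R1: each endpoint y yields the endpoints rho y and rho y + 1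
   and all endpoints arise so, which is Horner's scheme for the rho-integers.
   Cutting R^_1 into R_1 and R^_j into R_2 | ... | R_(N-j+2) intertwines the two
   substitutions, so the first tiling refines the second. *)
Require Import Defs.
From HB Require Import structures.
From mathcomp Require Import all_boot all_order all_algebra.
From mathcomp Require Import all_classical all_reals.
Import Order.TTheory GRing.Theory Num.Theory.
Local Open Scope classical_set_scope.
Local Open Scope ring_scope.

(** * Growth of powers and prefixes of sequences *)

Lemma expr_unbounded {R : realType} (r x : R) : 1 < r -> exists n, x < r ^+ n.
Proof.
move=> r1; have r10 : 0 < r - 1 by rewrite subr_gt0.
(* [r ^+ n - 1] is [r - 1] times a sum of [n] powers, each at least 1, so [n] only has to exceed
   [x / (r - 1)]. *)
exists (Num.truncn (x / (r - 1))).+1; set n := _.+1.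
have xn : x < (r - 1) * n%:R by rewrite mulrC -ltr_pdivrMr // truncnS_gt.
apply: (lt_le_trans xn); apply: (@le_trans _ _ (r ^+ n - 1)).
  rewrite subrX1 ler_pM2l // -[n in n%:R]card_ord -sumr_const.
  by apply: ler_sum => i _; rewrite exprn_ege1 // ltW.
by rewrite gerBl.
Qed.

Lemma take_mkseq {T : Type} (f : nat -> T) (m n : nat) :
  (m <= n)%N -> take m (mkseq f n) = mkseq f m.
Proof. by move=> mn; rewrite /mkseq -map_take take_iota (minn_idPl mn). Qed.

Lemma flatten_map_rcons {A B : Type} (f : A -> seq B) (w : seq A) (a : A) :
  flatten (map f (rcons w a)) = flatten (map f w) ++ f a.
Proof. by rewrite map_rcons flatten_rcons. Qed.

Lemma inflation_tilingE {R : realType} {A : Type} (len : A -> R)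
    (rule : A -> seq A) (a0 : A) (n : nat) :
  inflation_tiling len rule a0 n =
  \sum_(a <- mkseq (limit_word rule a0) n) len a.
Proof.
rewrite big_map /inflation_tiling -[in RHS](subn0 n) -/(index_iota 0 n).
by rewrite big_mkord.
Qed.

Lemma tile_length_inflation {R : realType} {A : Type} (len : A -> R)
    (rule : A -> seq A) (a0 : A) (n : nat) :
  tile_length (inflation_tiling len rule a0) n = len (limit_word rule a0 n).
Proof.
by rewrite /tile_length /inflation_tiling big_ord_recr /= [_ + len _]addrC addrK.
Qed.

(** * The limit word as a fixed point of the substitution *)

Lemma inflation_word_all {R : realType} {A : Type} {P : pred A} {rho : R}
    {len : A -> R} {rule : A -> seq A} {a0 : A} :
  1 < rho -> inflation_substitution P rho len rule a0 ->
  forall k, all P (inflation_word rule a0 k).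
Proof.
move=> rho1 infl; elim=> [|k IH]; first by case: infl => Pa0 *; rewrite /= Pa0.
have [v [_ Pv ->]] := inflation_word_prefix rho1 infl k.
by rewrite all_cat IH.
Qed.

Lemma limit_word_label {R : realType} {A : Type} {P : pred A} {rho : R}
    {len : A -> R} {rule : A -> seq A} {a0 : A} :
  1 < rho -> inflation_substitution P rho len rule a0 ->
  forall n, P (limit_word rule a0 n).
Proof.
move=> rho1 infl n; have [sz _] := inflation_word_limit rho1 infl n.
by apply: (all_nthP a0 (inflation_word_all rho1 infl n)).
Qed.

(** All words are prefixes of one limit word, so a prefix of any of them is determined by its
    size. *)
Lemma inflation_word_catl {R : realType} {A : Type} {P : pred A} {rho : R}
    {len : A -> R} {rule : A -> seq A} {a0 : A} :
  1 < rho -> inflation_substitution P rho len rule a0 ->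
  forall k v w, inflation_word rule a0 k = v ++ w ->
  v = mkseq (limit_word rule a0) (size v).
Proof.
move=> rho1 infl k v w E; have [_] := inflation_word_limit rho1 infl k.
move/(congr1 (take (size v))); rewrite E take_size_cat // take_mkseq //.
by rewrite size_cat leq_addr.
Qed.

Lemma inflation_word_split {R : realType} {A : Type} {P : pred A} {rho : R}
    {len : A -> R} {rule : A -> seq A} {a0 : A} :
  1 < rho -> inflation_substitution P rho len rule a0 ->
  forall n, exists w,
  inflation_word rule a0 n = mkseq (limit_word rule a0) n ++ w.
Proof.
move=> rho1 infl n; have [sz E] := inflation_word_limit rho1 infl n.
exists (drop n (inflation_word rule a0 n)).
by rewrite -(take_mkseq _ _ _ (ltnW sz)) -E cat_take_drop.
Qed.

(** In the tiling this is the index of the endpoint that is [rho] times the [n]-th one. *)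
Definition inflated_index {A : Type} (rule : A -> seq A) (a0 : A) (n : nat) :=
  size (substitute rule (mkseq (limit_word rule a0) n)).

(** The image of a prefix of one word is a prefix of the next word, hence of the limit word. *)
Lemma substitute_limit_word {R : realType} {A : Type} {P : pred A} {rho : R}
    {len : A -> R} {rule : A -> seq A} {a0 : A} :
  1 < rho -> inflation_substitution P rho len rule a0 ->
  forall n, substitute rule (mkseq (limit_word rule a0) n) =
            mkseq (limit_word rule a0) (inflated_index rule a0 n).
Proof.
move=> rho1 infl n; have [w E] := inflation_word_split rho1 infl n.
apply: (inflation_word_catl rho1 infl n.+1 _ (substitute rule w)).
by rewrite -substitute_cat -E.
Qed.

Lemma inflated_indexS {A : Type} (rule : A -> seq A) (a0 : A) (n : nat) :
  inflated_index rule a0 n.+1 =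
  (inflated_index rule a0 n + size (rule (limit_word rule a0 n)))%N.
Proof.
by rewrite /inflated_index mkseqS /substitute flatten_map_rcons size_cat.
Qed.

Lemma limit_word_inflated {R : realType} {A : Type} {P : pred A} {rho : R}
    {len : A -> R} {rule : A -> seq A} {a0 : A} :
  1 < rho -> inflation_substitution P rho len rule a0 ->
  forall n m, (m < size (rule (limit_word rule a0 n)))%N ->
  limit_word rule a0 (inflated_index rule a0 n + m) =
  nth a0 (rule (limit_word rule a0 n)) m.
Proof.
move=> rho1 infl n m mlt.
have := substitute_limit_word rho1 infl n.+1.
rewrite inflated_indexS mkseqS.
rewrite {1}/substitute flatten_map_rcons -/(substitute rule _).
move/(congr1 (fun s => nth a0 s (inflated_index rule a0 n + m))).
rewrite nth_mkseq ?ltn_add2l // => <-.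
by rewrite nth_cat ltnNge leq_addr /= addKn.
Qed.

(** Two alphabets and a free factor serve both uses: [c = rho] for a substitution, [c = 1] for
    cutting tiles into smaller ones. *)
Lemma sum_substitute {R : realType} {A B : Type} (P : pred A)
    (f : A -> seq B) (len : A -> R) (len' : B -> R) (c : R) (w : seq A) :
  (forall a, P a -> \sum_(b <- f a) len' b = c * len a) -> all P w ->
  \sum_(b <- flatten (map f w)) len' b = c * \sum_(a <- w) len a.
Proof.
move=> H; elim: w => [|a w IH] /=; first by rewrite !big_nil mulr0.
by move=> /andP[Pa Pw]; rewrite big_cat big_cons /= H // IH // mulrDr.
Qed.

Lemma mkseq_limit_word_all {R : realType} {A : Type} {P : pred A} {rho : R}
    {len : A -> R} {rule : A -> seq A} {a0 : A} :
  1 < rho -> inflation_substitution P rho len rule a0 ->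
  forall n, all P (mkseq (limit_word rule a0) n).
Proof.
move=> rho1 infl n; elim: n => // n IH.
by rewrite mkseqS all_rcons IH (limit_word_label rho1 infl).
Qed.

(** * Inflation of the tiling *)

Lemma inflation_tiling_inflated {R : realType} {A : Type} {P : pred A} {rho : R}
    {len : A -> R} {rule : A -> seq A} {a0 : A} :
  1 < rho -> inflation_substitution P rho len rule a0 ->
  forall n, inflation_tiling len rule a0 (inflated_index rule a0 n) =
            rho * inflation_tiling len rule a0 n.
Proof.
move=> rho1 infl n; rewrite !inflation_tilingE.
rewrite -(substitute_limit_word rho1 infl).
have [_ _ _ sumP _] := infl.
exact: sum_substitute sumP (mkseq_limit_word_all rho1 infl n).
Qed.

Lemma inflation_tiling_is_tiling {R : realType} {A : Type} {P : pred A}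
    {rho : R} {len : A -> R} {rule : A -> seq A} {a0 : A} :
  1 < rho -> inflation_substitution P rho len rule a0 ->
  is_tiling (inflation_tiling len rule a0).
Proof.
move=> rho1 infl; have [Pa0 lenP _ sumP _] := infl; split.
- by rewrite /inflation_tiling big_ord0.
- move=> n; rewrite -subr_gt0 -/(tile_length _ n) tile_length_inflation.
  exact/lenP/(limit_word_label rho1 infl).
(* The [k]-th word has total length [rho ^+ k * len a0], which is unbounded in [k]. *)
move=> x; have [k xk] := expr_unbounded rho (x / len a0) rho1.
exists (size (inflation_word rule a0 k)); rewrite inflation_tilingE.
have [_ <-] := inflation_word_limit rho1 infl k.
suff -> : \sum_(a <- inflation_word rule a0 k) len a = rho ^+ k * len a0.
  by rewrite -ltr_pdivrMr ?lenP.
elim: k {xk} => [|k IH]; first by rewrite big_seq1 expr0 mul1r.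
rewrite exprS -mulrA -IH.
exact: sum_substitute sumP (inflation_word_all rho1 infl k).
Qed.

(** The rule in [inflationary] sees only the length of a tile; injectivity of [len] on prototiles
    recovers the label. *)
Lemma inflation_tiling_inflationary {R : realType} {A : Type} {P : pred A}
    {rho : R} {len : A -> R} {rule : A -> seq A} {a0 : A} :
  1 < rho -> inflation_substitution P rho len rule a0 ->
  (forall a b, P a -> P b -> len a = len b -> a = b) ->
  inflationary rho (inflation_tiling len rule a0).
Proof.
move=> rho1 infl inj; have [Pa0 lenP _ sumP _] := infl.
split; first exact: inflation_tiling_is_tiling infl.
(* [f] picks a prototile of length [l] and falls back on [a0] when there is none. *)
have /choice[f fP] : forall l, exists b,
    (exists2 a, P a & len a = l) -> P b /\ len b = l.
  move=> l; have [[a Pa al]|no] := pselect (exists2 a, P a & len a = l).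
    by exists a.
  by exists a0.
exists (fun l => map len (rule (f l))) => i /=.
have Pi := limit_word_label rho1 infl i.
have -> : f (tile_length (inflation_tiling len rule a0) i) = limit_word rule a0 i.
  rewrite tile_length_inflation; set l := len _.
  by have [|Pf lf] := fP l; [exists (limit_word rule a0 i) | apply: inj].
set k := inflated_index rule a0 i.
have nthE m : (m < size (rule (limit_word rule a0 i)))%N ->
    tile_length (inflation_tiling len rule a0) (k + m) =
    nth 0 (map len (rule (limit_word rule a0 i))) m.
  move=> ms; rewrite tile_length_inflation (nth_map a0) //.
  by rewrite (limit_word_inflated rho1 infl).
split; last exists k.
- move=> l /(nthP 0)[m]; rewrite size_map => ms <-.
  by exists (k + m)%N => //; rewrite nthE.
- by rewrite big_map tile_length_inflation sumP.
split.
- exact: (inflation_tiling_inflated rho1 infl).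
- by rewrite size_map -inflated_indexS (inflation_tiling_inflated rho1 infl).
- by move=> m; rewrite size_map; apply: nthE.
Qed.

(** * Refinement of tilings by cutting tiles *)

Lemma intertwined_substitution {A B : Type} (P : pred A) (rule : A -> seq A)
    (rule' : B -> seq B) (f : A -> seq B) (w : seq A) :
  (forall a, P a -> flatten (map f (rule a)) = substitute rule' (f a)) ->
  all P w ->
  flatten (map f (substitute rule w)) = substitute rule' (flatten (map f w)).
Proof.
move=> H; elim: w => //= a w IH /andP[Pa Pw].
by rewrite /substitute /= map_cat flatten_cat H // IH // -substitute_cat.
Qed.

(** Commuting with the substitutions, the cut [f] sends the [k]-th word to the [k]-th word. Prefixes
    go to prefixes of the same total length, so every endpoint survives. *)
Lemma intertwined_endpoints {R : realType} {A B : Type} {P : pred A}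
    {P' : pred B} {rho : R} {len : A -> R} {len' : B -> R}
    {rule : A -> seq A} {rule' : B -> seq B} {a0 : A} {b0 : B}
    (f : A -> seq B) :
  1 < rho -> inflation_substitution P rho len rule a0 ->
  inflation_substitution P' rho len' rule' b0 ->
  f a0 = [:: b0] ->
  (forall a, P a -> flatten (map f (rule a)) = substitute rule' (f a)) ->
  (forall a, P a -> \sum_(b <- f a) len' b = len a) ->
  endpoints (inflation_tiling len rule a0) `<=`
  endpoints (inflation_tiling len' rule' b0).
Proof.
move=> rho1 infl infl' f0 fr fl _ [n _ <-].
have fW k : flatten (map f (inflation_word rule a0 k)) = inflation_word rule' b0 k.
  elim: k => [|k IH]; first by rewrite /= f0.
  rewrite [RHS]/inflation_word iterS -/(inflation_word _ _ k) -IH.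
  exact: intertwined_substitution (inflation_word_all rho1 infl k).
have [w] := inflation_word_split rho1 infl n.
move/(congr1 (fun s => flatten (map f s))); rewrite fW map_cat flatten_cat.
set v := flatten (map f (mkseq _ _)).
move/(inflation_word_catl rho1 infl') => vE; exists (size v) => //.
rewrite !inflation_tilingE -vE -[RHS]mul1r.
apply: sum_substitute (mkseq_limit_word_all rho1 infl n) => a Pa.
by rewrite mul1r fl.
Qed.

(** * Horner's scheme for the rho-integers *)

Lemma rho_integers_ind {R : realType} (rho : R) (E : set R) :
  E 0 -> (forall x, E x -> E (rho * x)) -> (forall x, E x -> E (rho * x + 1)) ->
  rho_integers rho `<=` E.
Proof.
move=> E0 EM ES _ [_ [n [c ->]]].
have Ec x (b : bool) : E x -> E (rho * x + b%:R).
  by case: b => Ex; [apply: ES | rewrite addr0; apply: EM].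
elim: n c => [|n IH] c.
  by rewrite big_ord1 subnn expr0 mulr1 -[_%:R]add0r -{1}[0](mulr0 rho); apply: Ec.
rewrite big_ord_recr /= subnn expr0 mulr1.
have /(Ec _ (c ord_max)) := IH (fun i => c (widen_ord (leqnSn n.+1) i)).
congr (E (_ + _)); rewrite mulr_sumr; apply: eq_bigr => i _.
by rewrite subSn -1?ltnS // exprS mulrCA.
Qed.

Lemma rho_integers_horner {R : realType} (rho x : R) (b : bool) :
  0 <= rho -> rho_integers rho x -> rho_integers rho (rho * x + b%:R).
Proof.
move=> r0 [x0 [n [c xE]]]; split; first by rewrite addr_ge0 ?mulr_ge0.
(* Multiplying by [rho] shifts the old digits; [b] becomes the new last digit, at [ord_max]. *)
exists n.+1, (fun i => if unlift ord_max i is Some j then c j else b).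
rewrite big_ord_recr /= unlift_none subnn expr0 mulr1 xE mulr_sumr.
congr (_ + _); apply: eq_bigr => i _.
have -> : widen_ord (leqnSn n.+1) i = lift ord_max i.
  by apply: val_inj; rewrite /= /bump leqNgt ltn_ord.
by rewrite liftK subSn -1?ltnS // exprS mulrCA.
Qed.

Lemma rho_integers0 {R : realType} (rho : R) : rho_integers rho 0.
Proof.
split=> //; exists 0%N, (fun=> false).
by rewrite big1 // => i _; rewrite mul0r.
Qed.

(** * Lengths and endpoints of the second tiling *)

Lemma len_hatR_label {R : realType} {N : nat} {rho : R} {j : nat} :
  0 < rho -> root (nbonacci_poly R N) rho -> is_label N j ->
  len_hatR N rho j = \sum_(1 <= i < (N - j + 1).+1) rho ^- i.
Proof.
move=> r0 rr /andP[j1 jN]; rewrite /len_hatR; case: eqP => [j1E|//].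
by rewrite j1E in jN *; rewrite subnK // (nbonacci_root_sum r0 rr).
Qed.

(** A smaller label has a longer sum of positive terms, hence a strictly larger length. *)
Lemma len_hatR_inj {R : realType} {N : nat} {rho : R} {a b : nat} :
  0 < rho -> root (nbonacci_poly R N) rho -> is_label N a -> is_label N b ->
  len_hatR N rho a = len_hatR N rho b -> a = b.
Proof.
move=> r0 rr; wlog ab : a b / (a < b)%N.
  move=> H Pa Pb E; case: (ltngtP a b) => // ab; first exact: H.
  by symmetry; apply: H.
move=> Pa Pb; rewrite !len_hatR_label // => E; exfalso; move: E.
have /andP[_ bN] := Pb.
rewrite (@big_cat_nat _ _ _ (N - b + 1).+1 1 (N - a + 1).+1) //=; last first.
  by rewrite ltnS leq_add2r leq_sub2l // ltnW.
move/eqP; rewrite addrC -subr_eq0 addrK gt_eqF //.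
rewrite big_ltn ?ltnS ?ltn_add2r ?ltn_sub2l ?(leq_trans ab) //.
rewrite ltr_pwDl ?invr_gt0 ?exprn_gt0 //.
by apply: sumr_ge0 => i _; rewrite invr_ge0 exprn_ge0 // ltW.
Qed.

Lemma limit_hatR_inflated {R : realType} {N : nat} {rho : R} (n : nat) :
  1 < rho -> inflation_substitution (is_label N) rho (len_hatR N rho)
    (rule_hatR N) 1%N ->
  limit_word (rule_hatR N) 1%N (inflated_index (rule_hatR N) 1%N n) = 1%N.
Proof.
move=> rho1 infl.
have := limit_word_inflated rho1 infl n 0%N; rewrite addn0 => -> //;
  by rewrite /rule_hatR; case: ifP.
Qed.

Lemma tiling_hatR_inflatedS {R : realType} {N : nat} {rho : R} (n : nat) :
  1 < rho -> inflation_substitution (is_label N) rho (len_hatR N rho)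
    (rule_hatR N) 1%N ->
  tiling_hatR N rho (inflated_index (rule_hatR N) 1%N n).+1 =
  rho * tiling_hatR N rho n + 1.
Proof.
move=> rho1 infl; rewrite -(inflation_tiling_inflated rho1 infl).
rewrite {1}/tiling_hatR /inflation_tiling big_ord_recr /=.
by rewrite (limit_hatR_inflated n rho1 infl) {2}/len_hatR.
Qed.

(** Rules have one or two letters, so [inflated_index] grows by 1 or 2 at a time, and its values
    with their successors exhaust all indices. The bound on [i] serves the strong induction on
    endpoints. *)
Lemma inflated_index_hatR_cover {N : nat} : (1 < N)%N ->
  forall n, exists i, (i <= n.-1)%N /\
    (n = inflated_index (rule_hatR N) 1%N i \/
     n = (inflated_index (rule_hatR N) 1%N i).+1).
Proof.
move=> N1 n; set g := inflated_index _ _.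
have gS i : g i.+1 = (g i).+1 \/ g i.+1 = (g i).+2.
  rewrite /g inflated_indexS /rule_hatR; case: ifP => _ /=.
    by right; rewrite addn2.
  by left; rewrite addn1.
have g1 : g 1%N = 2%N.
  by rewrite /g inflated_indexS /inflated_index /= /limit_word /= /rule_hatR N1.
(* Strengthened for the induction: the successor form is kept for two-tile blocks, so that the next
   index starts block [i.+1]. *)
suff [i [ile [nE|[nE _]]]] : exists i, (i <= n.-1)%N /\
    (n = g i \/ n = (g i).+1 /\ g i.+1 = (g i).+2).
- by exists i; split => //; left.
- by exists i; split => //; right.
elim: n => [|n [i [ile [nE|[nE giE]]]]]; first by exists 0%N; split; last by left.
- have [giE|giE] := gS i; last first.
    exists i; split; first by rewrite (leq_trans ile) ?leq_pred.
    by right; rewrite nE.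
  exists i.+1; split; last by left; rewrite giE nE.
  (* For [n = 0] the bound on [i.+1] would fail; this case is excluded because the first block has
     two tiles. *)
  case: n ile nE => [|n] //=; rewrite leqn0 => /eqP i0; rewrite i0 in giE *.
  by rewrite g1 in giE *; case: giE => <-.
- exists i.+1; split; last by left; rewrite giE nE.
  by rewrite nE /= in ile *.
Qed.

Lemma endpoints_tiling_hatR {R : realType} {N : nat} {rho : R} :
  (1 < N)%N -> 1 < rho -> inflation_substitution (is_label N) rho
    (len_hatR N rho) (rule_hatR N) 1%N ->
  endpoints (tiling_hatR N rho) = rho_integers rho.
Proof.
move=> N1 rho1 infl; have r0 : 0 <= rho by rewrite ltW // (lt_trans ltr01).
have y0 : tiling_hatR N rho 0%N = 0 by case: (inflation_tiling_is_tiling rho1 infl).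
apply/seteqP; split; last first.
  apply: rho_integers_ind; first by exists 0%N.
    move=> _ [n _ <-]; exists (inflated_index (rule_hatR N) 1%N n) => //.
    exact: (inflation_tiling_inflated rho1 infl).
  move=> _ [n _ <-]; exists (inflated_index (rule_hatR N) 1%N n).+1 => //.
  exact: tiling_hatR_inflatedS.
(* A positive index comes from a smaller one by inflation, which appends the digit 0 or 1 to a
   rho-integer. *)
move=> _ [n _ <-]; elim/ltn_ind: n => -[_|n IH].
  by rewrite y0; apply: rho_integers0.
have [i [/IH Zi [->|->]]] := inflated_index_hatR_cover N1 n.+1.
  rewrite [tiling_hatR _ _ _](inflation_tiling_inflated rho1 infl) -[_ * _]addr0.
  exact: (rho_integers_horner _ _ false).
by rewrite (tiling_hatR_inflatedS _ rho1 infl); apply: (rho_integers_horner _ _ true).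
Qed.

(** * Cutting the second tiling into the first *)

(** Since [rho ^- i] is the length of R_(i+1), the terms of [len_hatR] give R_2, ..., R_(N-j+2). For
    [j = 1] this would reach the label N+1, so R_1 stays uncut. *)
Definition cut_hatR (N j : nat) : seq nat :=
  if j == 1%N then [:: 1%N] else iota 2 (N - j + 1).

Lemma substitute_rule_R_iota (N m n : nat) :
  substitute (rule_R N) (iota m.+2 n) = iota m.+1 n.
Proof. by elim: n m => //= n IH m; rewrite -[in RHS](IH m.+1). Qed.

(** For [j = 1] both sides are R_1 | ... | R_N. For larger [j], lowering the labels by 1 leaves R_1
    followed by R_2 | ... | R_(N-j+1), the cut of label [j.+1], which is absent when [j = N]. *)
Lemma cut_hatR_intertwines {N j : nat} : (1 < N)%N -> is_label N j ->
  flatten (map (cut_hatR N) (rule_hatR N j)) =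
  substitute (rule_R N) (cut_hatR N j).
Proof.
move=> N1 /andP[j1 jN]; rewrite {2}/cut_hatR; case: eqP => [->|/eqP jn1].
  rewrite /rule_hatR N1 /= /cut_hatR /= /substitute /= !cats0 /rule_R eqxx.
  by case: N N1 {jN} => [|[|n]] // _; rewrite subn2 addn1.
rewrite substitute_rule_R_iota /rule_hatR; case: ltnP => jN'.
  rewrite /= cats0 /cut_hatR eqSS gtn_eqF //.
  by rewrite -(subnSK jN') !addn1.
have -> : j = N by apply/eqP; rewrite eqn_leq jN.
by rewrite subnn.
Qed.

Lemma sum_cut_hatR {R : realType} {N : nat} {rho : R} (j : nat) :
  \sum_(b <- cut_hatR N j) len_R rho b = len_hatR N rho j.
Proof.
rewrite /cut_hatR /len_hatR; case: eqP => _.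
  by rewrite big_seq1 /len_R subnn expr0 invr1.
rewrite (iotaDl 1 1) big_map /index_iota subn1 /=.
by apply: eq_bigr => i _; rewrite /len_R addKn.
Qed.

Theorem theorem4p10 (R : realType) (N : nat) (rho : R)
    (N_ge3 : (3 <= N)%N) (rho_gt0 : 0 < rho)
    (rho_root : root (nbonacci_poly R N) rho) :
  (rho_integers rho `<=` endpoints (tiling_R N rho) /\
   exists Z : nat -> R,
     endpoints Z = rho_integers rho /\ subordinate Z (tiling_R N rho)) /\
  (inflationary rho (tiling_hatR N rho) /\
   endpoints (tiling_hatR N rho) = rho_integers rho).
Proof.
have N1 : (1 < N)%N by apply: leq_trans N_ge3.
have rho1 := nbonacci_root_gt1 N_ge3 rho_gt0 rho_root.
have infl := inflation_substitution_R N_ge3 rho_gt0 rho_root.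
have inflh := inflation_substitution_hatR N_ge3 rho_gt0 rho_root.
have Eh := endpoints_tiling_hatR N1 rho1 inflh.
have sub : endpoints (tiling_hatR N rho) `<=` endpoints (tiling_R N rho).
  apply: (intertwined_endpoints (cut_hatR N) rho1 inflh infl) => // a Pa.
    exact: cut_hatR_intertwines.
  exact: sum_cut_hatR.
split; split=> //; first by rewrite -Eh.
  (* The second tiling itself enumerates the rho-integers in increasing order. *)
  exists (tiling_hatR N rho); split=> //; split=> //.
    exact: inflation_tiling_is_tiling inflh.
  exact: inflation_tiling_is_tiling infl.
apply: inflation_tiling_inflationary inflh _ => // a b.
exact: len_hatR_inj.
Qed.
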